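(* Let $s\in\mathbb{R}$, $s\neq 0$, and let $A\subset\Omega$ be measurable with $\mu(A)\ne 0$. (a) Let $\varphi_1,\varphi_2\in\Phi_1^{(1)}$ be such that the left derivative $(\varphi_1)'_l(1)$ of $\varphi_1$ at $1$ exists and is positive. Let $p_1\in\mathcal{F}^+\cap\mathcal{L}_{s,A}$ and $p_2\in\mathcal{F}\cap\mathcal{L}_{s,A}$ be such that $\sup_{x\in A}\frac{p_2(x)}{p_1(x)}<a_1$ for some constant $a_1<\infty$. Then $$(\varphi_1)'_l(1)\lim_{\varepsilon\to0^+}\frac{\|p_1\widetilde{+}_{\varphi,\varepsilon}p_2\|_{s,A}^s-\|p_1\|_{s,A}^s}{s\cdot\varepsilon}=\int_A\varphi_2\left(\frac{p_2(x)}{p_1(x)}\right)[p_1(x)]^s\,d\mu(x).$$ (b) Let $\varphi_1,\varphi_2\in\Psi_1^{(1)}$ be such that the right derivative $(\varphi_1)'_r(1)$ of $\varphi_1$ at $1$ exists and is nonzero. Let $p_1,p_2\in\mathcal{F}^+\cap\mathcal{L}_{s,A}$ be such that $\inf_{x\in A}\frac{p_2(x)}{p_1(x)}>a_2$ for some constant $a_2>0$. Then $$(\varphi_1)'_r(1)\lim_{\varepsilon\to0^+}\frac{\|p_1\widetilde{+}_{\varphi,\varepsilon}p_2\|_{s,A}^s-\|p_1\|_{s,A}^s}{s\cdot\varepsilon}=\int_A\varphi_2\left(\frac{p_2(x)}{p_1(x)}\right)[p_1(x)]^s\,d\mu(x).$$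
   Context: $\Omega$ is a nonempty measurable space with a given measure $\mu$, $\mu(\Omega)\neq0$. $\mathcal{F}$ is the set of nonnegative real-valued measurable functions on $\Omega$ and $\mathcal{F}^+$ the set of those that are positive everywhere. $\Phi_1$ is the set of continuous strictly increasing functions $\varphi:[0,\infty)\to[0,\infty)$ with $\varphi(0)=0$ and $\lim_{t\to\infty}\varphi(t)=\infty$. $\Psi_1$ is the set of continuous strictly decreasing functions $\varphi:(0,\infty)\to(0,\infty)$ with $\lim_{t\to0}\varphi(t)=\infty$ and $\lim_{t\to\infty}\varphi(t)=0$. $\Phi_1^{(1)}$ (resp. $\Psi_1^{(1)}$) is the set of $\varphi\in\Phi_1$ (resp. $\varphi\in\Psi_1$) with $\varphi(1)=1$. For $s\ne0$, $\|p\|_{s,A}^s=\int_A p(x)^s\,d\mu(x)$, defined for $p\in\mathcal{F}$ if $s>0$ and for $p\in\mathcal{F}^+$ if $s<0$; $\mathcal{L}_{s,A}$ is the set of such functions $p$ with $\|p\|_{s,A}^s<\infty$. Linear Orlicz addition: for $\varepsilon>0$, $\varphi_1,\varphi_2\in\Phi_1$ and $p_1,p_2\in\mathcal{F}$ (or $\varphi_1,\varphi_2\in\Psi_1$ and $p_1,p_2\in\mathcal{F}^+$), the function $p_1\widetilde{+}_{\varphi,\varepsilon}p_2$ is defined at $x$ with $p_1(x)+p_2(x)>0$ as the unique $\lambda>0$ such that $$\varphi_1\left(\frac{p_1(x)}{\lambda}\right)+\varepsilon\,\varphi_2\left(\frac{p_2(x)}{\lambda}\right)=1,$$ and as $0$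 if $p_1(x)+p_2(x)=0$. *)

(* Defs.v *)
From HB Require Import structures.
From mathcomp Require Import all_boot all_order all_algebra.
From mathcomp Require Import all_classical all_reals all_analysis.

Set Implicit Arguments.
Unset Strict Implicit.
Unset Printing Implicit Defensive.

Import Order.TTheory GRing.Theory Num.Theory.
Import numFieldNormedType.Exports.

Local Open Scope classical_set_scope.
Local Open Scope ring_scope.

(* Functions with domain [0, +oo[ or ]0, +oo[ are total functions R -> R whose
   values outside of that domain are left unconstrained and are never used. *)

Section OrliczFunctions.
Context {R : realType}.

Definition Phi1 : set (R -> R) := [set phi : R -> R |
  [/\ {in `[0, +oo[, forall t, 0 <= phi t},
      {within `[0, +oo[, continuous phi},
      {in `[0, +oo[ &, forall x y, x < y -> phi x < phi y},
      phi 0 = 0 &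
      phi t @[t --> +oo] --> +oo]].

Definition Psi1 : set (R -> R) := [set phi : R -> R |
  [/\ {in `]0, +oo[, forall t, 0 < phi t},
      {within `]0, +oo[, continuous phi},
      {in `]0, +oo[ &, forall x y, x < y -> phi y < phi x},
      phi t @[t --> 0^'+] --> +oo &
      phi t @[t --> +oo] --> 0]].

Definition Phi11 : set (R -> R) := [set phi : R -> R | Phi1 phi /\ phi 1 = 1].

Definition Psi11 : set (R -> R) := [set phi : R -> R | Psi1 phi /\ phi 1 = 1].

Definition diff_quot (f : R -> R) (x h : R) : R := (f (x + h) - f x) / h.

Definition left_derivable (f : R -> R) (x : R) : Prop :=
  cvg (diff_quot f x h @[h --> 0^'-]).

Definition left_derive (f : R -> R) (x : R) : R :=
  lim (diff_quot f x h @[h --> 0^'-]).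

Definition right_derivable (f : R -> R) (x : R) : Prop :=
  cvg (diff_quot f x h @[h --> 0^'+]).

Definition right_derive (f : R -> R) (x : R) : R :=
  lim (diff_quot f x h @[h --> 0^'+]).

End OrliczFunctions.

Section MeasurableFunctions.
Context {d : measure_display} {T : measurableType d} {R : realType}.

Definition calF : set (T -> R) :=
  [set p : T -> R | measurable_fun setT p /\ forall x, 0 <= p x].

Definition calFpos : set (T -> R) :=
  [set p : T -> R | measurable_fun setT p /\ forall x, 0 < p x].

Definition norm_pow (mu : {measure set T -> \bar R}) (s : R) (A : set T)
    (p : T -> R) : \bar R :=
  (\int[mu]_(x in A) (p x `^ s)%:E)%E.

(* Only meaningful for s != 0. *)
Definition calL (mu : {measure set T -> \bar R}) (s : R) (A : set T) :
    set (T -> R) :=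
  [set p : T -> R | (if 0 < s then calF p else calFpos p) /\
           (norm_pow mu s A p < +oo)%E].

(* For arguments in the classes considered (Phi1 and calF, or Psi1 and calFpos)
   and eps > 0, the set below is a singleton whenever 0 < p1 x + p2 x, and the
   default value 0 of xget is not used. *)
Definition orlicz_add (phi1 phi2 : R -> R) (eps : R) (p1 p2 : T -> R) :
    T -> R :=
  fun x =>
    if 0 < p1 x + p2 x then
      xget 0 [set lambda : R | 0 < lambda /\
        phi1 (p1 x / lambda) + eps * phi2 (p2 x / lambda) = 1]
    else 0.

Definition orlicz_quot (mu : {measure set T -> \bar R}) (s : R) (A : set T)
    (phi1 phi2 : R -> R) (p1 p2 : T -> R) (eps : R) : \bar R :=
  ((norm_pow mu s A (orlicz_add phi1 phi2 eps p1 p2) - norm_pow mu s A p1)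
     / (s * eps)%:E)%E.

End MeasurableFunctions.

(* Main.v *)
Require Import Defs.
From mathcomp Require Import all_boot all_order all_algebra.
From mathcomp Require Import all_classical all_reals all_analysis.
From mathcomp Require Import measurable_realfun ring lra.

(** Part (a). Write lambda for the Orlicz sum at a point, u = p1 / lambda and
r = p2 / p1, so that the defining equation reads

  phi1 u + eps * phi2 (r * u) = 1.

Since r is bounded on A and phi1 1 = 1, this forces u to tend to 1 from the
left as eps -> 0+, uniformly on A ([sol_near_one]). Where u < 1, replacing eps
by (1 - phi1 u) / phi2 (r * u) removes eps from the pointwise quotient
([powR_variationE]):

  (lambda^s - p1^s) / (s * eps)
    = phi2 (r * u) * ((u^(-s) - 1) / (s * (1 - phi1 u))) * p1^s.

The middle factor depends on u only and is a quotient of two difference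
quotients at 1, those of t |-> t^(-s) and of phi1, so it tends to the inverse
of the left derivative of phi1 at 1 ([powR_ratio_cvg]). Hence the pointwise
quotient tends to phi2 r * p1^s divided by that derivative, and for small eps
it is bounded by a constant multiple of p1^s, which is integrable on A. The
dominated convergence theorem concludes ([orlicz_quot_cvg]). The Orlicz sum is
measurable because the defining equation is monotone in lambda, which turns its
superlevel sets into those of an explicit measurable function
([le_orlicz_add]).

Part (b) is part (a) in disguise. If phi is in the decreasing class, then
t |-> phi (1/t), extended by 0 at 0, is in the increasing one, and lambda
solves the equation for (phi1, phi2, p1, p2) exactly when 1/lambda solves it
for the transformed functions and (1/p1, 1/p2). Replacing s by -s keeps every
s-norm and every integral, changes the sign of the quotient
([orlicz_quot_inv_arg]), and a right derivative at 1 becomes the opposite of a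
left one ([cvg_diff_quot_inv_arg]). *)

Set Implicit Arguments.
Unset Strict Implicit.
Unset Printing Implicit Defensive.

Import Order.TTheory GRing.Theory Num.Theory.
Import numFieldNormedType.Exports.
Local Open Scope classical_set_scope.
Local Open Scope ring_scope.

(** * The Orlicz sum of functions *)

Section OrliczAddition.
Context {R : realType}.
Implicit Types (phi : R -> R) (t u v : R).

Lemma Phi1_ge0 phi t : Phi1 phi -> 0 <= t -> 0 <= phi t.
Proof. by case=> phi0 _ _ _ _ t0; apply: phi0; rewrite in_itv/= t0. Qed.

Lemma Phi1_lt phi u v : Phi1 phi -> 0 <= u -> u < v -> phi u < phi v.
Proof.
case=> _ _ phi_lt _ _ u0 uv; apply: phi_lt => //.
  by rewrite in_itv/= u0.
by rewrite in_itv/= andbT (le_trans u0)// ltW.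
Qed.

Lemma Phi1_le phi u v : Phi1 phi -> 0 <= u -> u <= v -> phi u <= phi v.
Proof.
move=> Phi u0; rewrite le_eqVlt => /predU1P[->//|uv].
by rewrite ltW// Phi1_lt.
Qed.

(** Precomposing with the projection onto [0, +oo[ yields a function that is
continuous on the whole line, which spares one-sided continuity at 0: the
function p2, hence the argument of phi2, is allowed to vanish. *)
Lemma Phi1_max0_continuous phi : Phi1 phi ->
  continuous (fun t => phi (Num.max 0 t)).
Proof.
case=> _ /subspace_continuousP cphi _ _ _ t.
have max_ge0 u : Num.max 0 u \in `[0, +oo[ by rewrite in_itv/= le_max lexx.
apply/cvgrPdist_lt => e e0.
have /cvgrPdist_lt/(_ e e0) := cphi (Num.max 0 t) (max_ge0 t).
rewrite near_withinE => /nbhs_ballP[r /= r0 phir].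
near=> u; apply: phir; last exact: max_ge0.
rewrite /ball/=; apply: (@le_lt_trans _ _ `|t - u|).
  have := ler_norm (u - t); rewrite distrC; have := ler_norm (t - u).
  by rewrite ler_norml !maxEle; case: ifPn; case: ifPn; rewrite -?ltNge; lra.
near: u; exact: cvgr_dist_lt.
Unshelve. all: by end_near. Qed.

Lemma Phi1_cvg phi (I : Type) (F : set_system I) (f : I -> R) l :
  Phi1 phi -> f i @[i --> F] --> l ->
  phi (Num.max 0 (f i)) @[i --> F] --> phi (Num.max 0 l).
Proof.
by move=> Phi fl; have := @Phi1_max0_continuous _ Phi l; exact: cvg_comp.
Qed.

Lemma Phi1_measurable phi : Phi1 phi ->
  measurable_fun setT (fun t => phi (Num.max 0 t)).
Proof. by move=> /Phi1_max0_continuous/continuous_measurable_fun. Qed.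

Variables (phi1 phi2 : R -> R).
Hypotheses (Phi_1 : Phi1 phi1) (Phi_2 : Phi1 phi2).

(* With v the inverse of lambda, the equation says that G takes the value 1,
   where G is increasing and continuous on [0, +oo[. *)
Let G (eps a b v : R) := phi1 (a * v) + eps * phi2 (b * v).

Let G_lt eps a b v w : 0 < eps -> 0 < a -> 0 <= b -> 0 <= v -> v < w ->
  G eps a b v < G eps a b w.
Proof.
move=> e0 a0 b0 v0 vw; apply: ltr_leD.
  by apply: Phi1_lt => //; rewrite ?ltr_pM2l// mulr_ge0// ltW.
rewrite ler_pM2l//; apply: Phi1_le => //; first by rewrite mulr_ge0.
by rewrite ler_wpM2l// ltW.
Qed.

Let G_root eps a b : 0 < eps -> 0 < a -> 0 <= b ->
  exists2 v, 0 < v & G eps a b v = 1.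
Proof.
move=> e0 a0 b0.
have G0 : G eps a b 0 = 0.
  rewrite /G !mulr0; case: Phi_1 Phi_2 => _ _ _ -> _ [_ _ _ -> _].
  by rewrite mulr0 addr0.
have [M M0 GM] : exists2 M, 0 < M & 1 <= G eps a b M.
  case: (Phi_1) => _ _ _ _ /cvgryPge/(_ 1) [N [_ NP]].
  exists (Num.max 1 ((N + 1) / a)); first by rewrite lt_max ltr01.
  rewrite -[1 in leLHS]addr0 lerD//.
    apply: NP => /=; rewrite maxr_pMr ?(ltW a0)// lt_max; apply/orP; right.
    by rewrite mulrC divfK ?gt_eqF// ltrDl.
  rewrite mulr_ge0 ?(ltW e0)// Phi1_ge0// mulr_ge0//.
  by rewrite le_max ler01.
pose G' v := phi1 (Num.max 0 (a * v)) + eps * phi2 (Num.max 0 (b * v)).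
have G'E v : 0 <= v -> G' v = G eps a b v.
  by move=> v0; rewrite /G' !max_r// mulr_ge0// ltW.
have cG' : continuous G'.
  move=> v; apply: cvgD; last (apply: cvgM; first exact: cvg_cst).
    exact/(Phi1_cvg Phi_1)/mulrl_continuous.
  exact/(Phi1_cvg Phi_2)/mulrl_continuous.
have [||v] := @IVT R G' 0 M 1 (ltW M0); first exact: continuous_subspaceT.
  by rewrite !G'E ?(ltW M0)// G0 ge_min ler01/= le_max GM orbT.
rewrite in_itv/= => /andP[v0 _]; rewrite G'E// => Gv; exists v => //.
rewrite lt_neqAle v0 andbT; apply/eqP => v00.
by move: Gv; rewrite -v00 G0 => /eqP; rewrite eq_sym oner_eq0.
Qed.

Lemma orlicz_eq_unique eps a b v w : 0 < eps -> 0 < a -> 0 <= b ->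
  0 < v -> 0 < w ->
  phi1 (a / v) + eps * phi2 (b / v) = 1 ->
  phi1 (a / w) + eps * phi2 (b / w) = 1 -> v = w.
Proof.
move=> e0 a0 b0 v0 w0 Gv Gw; apply: invr_inj; apply/eqP.
rewrite eq_le !leNgt; apply/andP; split; apply/negP.
  by move=> /(G_lt e0 a0 b0 (ltW _)); rewrite /G Gv Gw ltxx invr_gt0 => /(_ w0).
by move=> /(G_lt e0 a0 b0 (ltW _)); rewrite /G Gv Gw ltxx invr_gt0 => /(_ v0).
Qed.

Section Pointwise.
Context {d : measure_display} {T : measurableType d}.
Implicit Type x : T.

Lemma orlicz_addP eps (p1 p2 : T -> R) x : 0 < eps -> 0 < p1 x -> 0 <= p2 x ->
  let lam := orlicz_add phi1 phi2 eps p1 p2 x in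
  0 < lam /\ phi1 (p1 x / lam) + eps * phi2 (p2 x / lam) = 1.
Proof.
move=> e0 a0 b0 /=; rewrite /orlicz_add ltr_wpDr//.
case: xgetP => [lam _ //|noroot]; have [v v0 Gv] := G_root e0 a0 b0.
by case: (noroot v^-1) => /=; rewrite invr_gt0 invrK; split.
Qed.

(** The left-hand side of the defining equation decreases in lambda, so it is
at least 1 exactly at the points c not exceeding the root. This describes the
superlevel sets of the Orlicz sum without the root. *)
Lemma le_orlicz_add eps (p1 p2 : T -> R) x c :
  0 < eps -> 0 < p1 x -> 0 <= p2 x -> 0 < c ->
  (c <= orlicz_add phi1 phi2 eps p1 p2 x) =
  (1 <= phi1 (p1 x / c) + eps * phi2 (p2 x / c)).
Proof.
move=> e0 a0 b0 c0; have [lam0 eqlam] := orlicz_addP e0 a0 b0.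
move: lam0 eqlam; set lam := orlicz_add _ _ _ _ _ _ => lam0 eqlam.
have Gmono := @G_lt eps _ _ _ _ e0 a0 b0.
apply/idP/idP; rewrite !leNgt; apply: contra.
  rewrite -eqlam => Glt; rewrite ltNge; apply/negP.
  rewrite le_eqVlt => /predU1P[clam|clam]; first by rewrite clam ltxx in Glt.
  have /Gmono : 0 <= lam^-1 by rewrite invr_ge0 ltW.
  by move/(_ c^-1); rewrite ltf_pV2// => /(_ clam); rewrite /G ltNge (ltW Glt).
move=> lamc; have /Gmono : 0 <= c^-1 by rewrite invr_ge0 ltW.
by move/(_ lam^-1); rewrite ltf_pV2// => /(_ lamc); rewrite /G eqlam.
Qed.

Lemma measurable_orlicz_add eps (p1 p2 : T -> R) :
  0 < eps -> calFpos p1 -> calF p2 ->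
  measurable_fun setT (orlicz_add phi1 phi2 eps p1 p2).
Proof.
move=> e0 [mp1 p1_gt0] [mp2 p2_ge0].
apply: (measurability (@RGenCInfty.G R)) => [|/= _ [_] [c] -> <-].
  exact: RGenCInfty.measurableE.
rewrite setTI; have [c0|c0] := leP c 0.
  rewrite (_ : _ @^-1` _ = setT)//; apply/seteqP; split => // x _ /=.
  rewrite in_itv/= andbT (le_trans c0)// ltW//.
  by have [] := orlicz_addP e0 (p1_gt0 x) (p2_ge0 x).
pose S x := phi1 (Num.max 0 (p1 x / c)) + eps * phi2 (Num.max 0 (p2 x / c)).
have mS : measurable_fun setT S.
  apply: measurable_funD; last apply: measurable_funM => //.
    apply: (measurableT_comp (Phi1_measurable Phi_1)).
    exact: measurable_funM.
  apply: (measurableT_comp (Phi1_measurable Phi_2)).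
  exact: measurable_funM.
rewrite (_ : _ @^-1` _ = S @^-1` `[1, +oo[).
  by rewrite -[X in measurable X]setTI; exact: mS.
apply/seteqP; split => x /=; rewrite !in_itv/= !andbT (le_orlicz_add e0)//;
  by rewrite /S !max_r// divr_ge0// ltW.
Qed.

End Pointwise.
End OrliczAddition.

(** * Behaviour of the solutions for small eps *)

Section LeftDifferenceQuotient.
Context {R : realType}.
Variables (phi : R -> R) (s : R).
Hypotheses (s0 : s != 0) (Phi_phi : Phi11 phi).
Hypotheses (dphi : left_derivable phi 1) (dphi_gt0 : 0 < left_derive phi 1).

(** The factor of the pointwise quotient that depends on u = p1 / lambda only.
Its value at 1 is its left limit there; u = 1 does occur, where p2 vanishes. *)
Definition powR_ratio (u : R) : R :=
  if u == 1 then (left_derive phi 1)^-1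
  else (u `^ (- s) - 1) / (s * (1 - phi u)).

Let powR_quot_cvg (a : R) :
  ((1 + h) `^ a - 1) / h @[h --> 0^'-] --> a.
Proof.
have [d1 D1] := @is_derive1_powR R a 1 ltr01.
rewrite powR1 mulr1 in D1; rewrite -[X in _ --> X]D1.
have /cvg_dnbhs_at_left := d1; apply: cvg_trans; apply: near_eq_cvg; near=> h.
by rewrite /= [h%:A]mulr1 powR1 (addrC h); exact: mulrC.
Unshelve. all: by end_near. Qed.

(** For u = 1 + h, dividing numerator and denominator by h displays the ratio
as the difference quotient of the power -s over -s times that of phi. *)
Lemma powR_ratio_cvg :
  powR_ratio (1 + h) @[h --> 0^'-] --> (left_derive phi 1)^-1.
Proof.
have [Phi phi11] := Phi_phi.
have dphiP : diff_quot phi 1 h @[h --> 0^'-] --> left_derive phi 1 := dphi.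
have : (((1 + h) `^ (- s) - 1) / h) * (- s)^-1 * (diff_quot phi 1 h)^-1
    @[h --> 0^'-] --> - s * (- s)^-1 * (left_derive phi 1)^-1.
  apply: cvgM; last by apply: cvgV => //; rewrite gt_eqF.
  by apply: cvgM; [exact: powR_quot_cvg|exact: cvg_cst].
rewrite divff ?oppr_eq0// mul1r; apply: cvg_trans; apply: near_eq_cvg.
near=> h.
have h0 : h < 0 by near: h; exact: nbhs_left_lt.
have h1 : -1 < h by near: h; apply: nbhs_left_gt; rewrite ltrN10.
have phih : phi (1 + h) < 1.
  by rewrite -[ltRHS]phi11; apply: Phi1_lt => //; lra.
rewrite /powR_ratio /diff_quot phi11 ifF; last by apply: lt_eqF; lra.
by field; rewrite s0 !subr_eq0 eq_sym (lt_eqF phih) (lt_eqF h0).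
Unshelve. all: by end_near. Qed.

Variables (phi2 : R -> R) (M : R).
Hypotheses (Phi_2 : Phi1 phi2) (M0 : 0 <= M).

Let sol (eps r u : R) :=
  [/\ 0 <= r <= M, 0 < u & phi u + eps * phi2 (r * u) = 1].

(** As phi2 is nonnegative, phi u <= 1 and thus u <= 1; but then
phi2 (r * u) <= phi2 M, so phi u >= 1 - eps * phi2 M. This lower bound is
independent of r, which makes the convergence of u to 1 uniform. *)
Lemma sol_near_one (t : R) : t < 1 ->
  \forall eps \near 0^'+, forall r u, sol eps r u -> t < u <= 1.
Proof.
have [Phi phi11] := Phi_phi; move=> t1; wlog t0 : t t1 / 0 <= t.
  move=> wh; have m1 : Num.max 0 t < 1 by rewrite gt_max ltr01.
  have := wh _ m1; rewrite le_max lexx => /(_ erefl).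
  apply: filterS => eps + r u => /[apply]; rewrite gt_max -andbA.
  by case/andP.
have phit : 0 < 1 - phi t by rewrite subr_gt0 -phi11 Phi1_lt.
(* phi2 M may be 0; adding 1 makes it a legitimate divisor. *)
have phiM : 0 < 1 + phi2 M by rewrite ltr_pwDl// Phi1_ge0.
near=> eps => r u [/andP[r0 rM] u0 eq1].
have e0 : 0 < eps by near: eps; exact: nbhs_right_gt.
have eM : eps * (1 + phi2 M) < 1 - phi t.
  by rewrite -ltr_pdivlMr//; near: eps; apply: nbhs_right_lt; rewrite divr_gt0.
have ru0 : 0 <= r * u by rewrite mulr_ge0// ltW.
have u1 : u <= 1.
  rewrite leNgt; apply/negP => /(Phi1_lt Phi ler01); rewrite phi11 => phiu.
  have : 0 <= eps * phi2 (r * u) by rewrite mulr_ge0 ?(ltW e0)// Phi1_ge0.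
  by move: eq1 phiu; lra.
rewrite u1 andbT ltNge; apply/negP => /(Phi1_le Phi (ltW u0)) phiut.
have : eps * phi2 (r * u) <= eps * (1 + phi2 M).
  rewrite ler_wpM2l ?(ltW e0)// ler_wpDl// Phi1_le//.
  by rewrite (le_trans _ rM)// ler_piMr.
by move: eq1 phiut eM; lra.
Unshelve. all: by end_near. Qed.

Lemma powR_ratio_near (e : R) : 0 < e ->
  \forall eps \near 0^'+, forall r u, sol eps r u ->
    `|(left_derive phi 1)^-1 - powR_ratio u| < e.
Proof.
move=> e0; have /cvgrPdist_lt/(_ e e0) := powR_ratio_cvg.
move=> -[k /= k0 kP].
have : 1 - k < 1 by rewrite ltrBlDr ltrDl.
move=> /sol_near_one; apply: filterS => eps + r u => /[apply] /andP[ku].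
rewrite le_eqVlt => /predU1P[->|u1].
  by rewrite /powR_ratio eqxx subrr normr0.
have := kP (u - 1).
rewrite /= sub0r opprB subr_lt0 u1 (addrC 1 (u - 1)) subrK; apply => //.
by rewrite gtr0_norm; lra.
Qed.

End LeftDifferenceQuotient.

(** * Dominated convergence along a right neighbourhood *)

Lemma cvg_to_at_right (R : realFieldType) (I : Type) (F : set_system I)
    (FF : Filter F) (f : I -> R) (a : R) :
  f i @[i --> F] --> a -> (\forall i \near F, a < f i) ->
  f i @[i --> F] --> a^'+.
Proof.
move=> fa af P aP.
have Pf : \forall i \near F, a < f i -> P (f i) := fa _ aP.
by apply: filterS2 Pf af => i /[apply].
Qed.

Section DominatedConvergence.
Context {d : measure_display} {T : measurableType d} {R : realType}.
Variables (mu : {measure set T -> \bar R}) (D : set T) (mD : measurable D).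

(** The sequential theorem applies along every sequence tending to a from the
right, once the finitely many terms where the domination may fail are shifted
away; and one-sided limits of real-valued functions are determined by
sequences. *)
Lemma dominated_cvg_at_right (a : R) (G : R -> T -> R) (g dom : T -> R) :
  (forall e, a < e -> measurable_fun D (G e)) ->
  (forall x, D x -> G e x @[e --> a^'+] --> g x) ->
  mu.-integrable D (EFin \o dom) ->
  (\forall e \near a^'+, forall x, D x -> `|G e x| <= dom x) ->
  [/\ mu.-integrable D (EFin \o g),
      \forall e \near a^'+, mu.-integrable D (EFin \o G e) &
      (\int[mu]_(x in D) (G e x)%:E)%E @[e --> a^'+]
        --> (\int[mu]_(x in D) (g x)%:E)%E].
Proof.
move=> mG Gg idom Gdom.
have seq_cvg (w : R^nat) : (forall n, a < w n) -> w n @[n --> \oo] --> a ->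
    mu.-integrable D (EFin \o g) /\
    (\int[mu]_(x in D) (G (w n) x)%:E)%E @[n --> \oo]
        --> (\int[mu]_(x in D) (g x)%:E)%E.
  move=> aw wa.
  have wr : w n @[n --> \oo] --> a^'+.
    by apply: cvg_to_at_right => //; exact: nearW.
  have [N _ NP] := wr _ Gdom.
  have GNg x : D x -> (G (w (n + N)%N) x)%:E @[n --> \oo] --> (g x)%:E.
    move=> Dx; apply: cvg_EFin; first exact: nearW.
    have := cvg_comp _ _ wr (Gg x Dx).
    by rewrite -(cvg_shiftn N).
  have mGN n : measurable_fun D (EFin \o G (w (n + N)%N)).
    exact/measurable_EFinP/mG.
  have [] := @dominated_convergence _ _ _ mu D mD
    (fun n => EFin \o G (w (n + N)%N)) (EFin \o g) (EFin \o dom).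
  - exact: mGN.
  - exact: emeasurable_fun_cvg mGN GNg.
  - exact: aeW.
  - exact: idom.
  - apply: aeW => x n Dx /=; rewrite lee_fin.
    by apply: NP => //=; rewrite leq_addl.
  by move=> ig _ cG; split => //; rewrite -(cvg_shiftn N).
have ig : mu.-integrable D (EFin \o g).
  have [||//] := seq_cvg (fun n => a + n.+1%:R^-1).
    by move=> n; rewrite ltrDl.
  rewrite -[X in _ --> X]addr0; apply: cvgD; first exact: cvg_cst.
  exact: cvg_harmonic.
have iG : \forall e \near a^'+, mu.-integrable D (EFin \o G e).
  near=> e; have ae : a < e by near: e; exact: nbhs_right_gt.
  have Ge : forall x, D x -> `|G e x| <= dom x by near: e.
  apply: le_integrable idom => //; first exact/measurable_EFinP/mG.
  by move=> x Dx /=; rewrite lee_fin (le_trans (Ge x Dx))// ler_norm.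
have fing : (\int[mu]_(x in D) (g x)%:E)%E \is a fin_num.
  exact: integrable_fin_num.
rewrite -(fineK fing); split => //; apply/fine_cvgP; split.
  by apply: filterS iG => e iGe; exact: integrable_fin_num.
apply/cvg_at_rightP => w [aw wa].
have [_ cw] := seq_cvg w aw wa.
by rewrite -(fineK fing) in cw; exact: fine_cvg cw.
Unshelve. all: by end_near. Qed.

End DominatedConvergence.

(** * First variation for increasing functions *)

Section Variation.
Context {d : measure_display} {T : measurableType d} {R : realType}.
Variables (mu : {measure set T -> \bar R}) (A : set T) (mA : measurable A).
Variables (s : R) (s0 : s != 0) (phi1 phi2 : R -> R).
Hypotheses (Phi_1 : Phi11 phi1) (Phi_2 : Phi1 phi2).
Hypotheses (dphi1 : left_derivable phi1 1) (dphi1_gt0 : 0 < left_derive phi1 1).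
Variables (p1 p2 : T -> R).
Hypotheses (Fp1 : calFpos p1) (Fp2 : calF p2).
Let lam eps := orlicz_add phi1 phi2 eps p1 p2.
Let G eps x := (lam eps x `^ s - p1 x `^ s) / (s * eps).
Let u eps x := p1 x / lam eps x.
Let r x := p2 x / p1 x.

Let r_ge0 x : 0 <= r x.
Proof. by rewrite divr_ge0 ?(ltW (Fp1.2 x))// Fp2.2. Qed.

Let lam_gt0 eps x : 0 < eps -> 0 < lam eps x.
Proof.
by move=> e0; have [] := orlicz_addP Phi_1.1 Phi_2 e0 (Fp1.2 x) (Fp2.2 x).
Qed.

Let u_eq eps x : 0 < eps ->
  0 < u eps x /\ phi1 (u eps x) + eps * phi2 (r x * u eps x) = 1.
Proof.
move=> e0; have [] := orlicz_addP Phi_1.1 Phi_2 e0 (Fp1.2 x) (Fp2.2 x).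
rewrite -/(lam eps) -/(u eps x) => l0; have a0 := Fp1.2 x.
by rewrite /r mulrA divfK ?gt_eqF// divr_gt0.
Qed.

(** The identity that eliminates eps. When u = 1 both sides vanish, because
   then the equation leaves eps * phi2 (r * u) = 0. *)
Let powR_variationE eps x : 0 < eps ->
  G eps x = phi2 (r x * u eps x) * powR_ratio phi1 s (u eps x) * p1 x `^ s.
Proof.
move=> e0; have [u0 eq1] := u_eq x e0; have [Phi phi11] := Phi_1.
have l0 := lam_gt0 x e0; have a0 := Fp1.2 x.
have lamE : lam eps x = p1 x * (u eps x)^-1.
  by rewrite invfM invrK mulrA divff ?mul1r// gt_eqF.
rewrite /powR_ratio; case: eqVneq => [u1|u1].
  have -> : phi2 (r x * u eps x) = 0.
    move: eq1; rewrite {1}u1 phi11 => /eqP.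
    by rewrite -subr_eq0 addrAC subrr add0r mulf_eq0 gt_eqF//= => /eqP.
  by rewrite !mul0r /G lamE u1 invr1 mulr1 subrr mul0r.
have phiu : 1 - phi1 (u eps x) != 0.
  rewrite subr_eq0; apply/negP => /eqP phiu.
  by move: u1; rewrite neq_lt => /orP[]/(Phi1_lt Phi);
    rewrite phi11 -phiu ltxx ?(ltW u0) ?ler01 => /(_ erefl).
have -> : phi2 (r x * u eps x) = (1 - phi1 (u eps x)) / eps.
  by rewrite -eq1 addrAC subrr add0r [RHS]mulrC mulKf// gt_eqF.
rewrite /G lamE powRM ?invr_ge0 ?(ltW u0) ?(ltW a0)//.
rewrite -powR_inv1 ?(ltW u0)// -powRrM mulN1r.
field.
by rewrite s0 phiu gt_eqF.
Qed.

Variable M : R.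
Hypotheses (M0 : 0 <= M) (rM : forall x, A x -> r x <= M).
Hypothesis Lp1 : (norm_pow mu s A p1 < +oo)%E.

Let powR_variation_cvg x : A x ->
  G eps x @[eps --> 0^'+]
    --> phi2 (r x) * (left_derive phi1 1)^-1 * p1 x `^ s.
Proof.
move=> Ax.
have u1 : u eps x @[eps --> 0^'+] --> (1 : R).
  apply/cvgrPdist_lt => e e0.
  have : 1 - e < 1 by rewrite ltrBlDr ltrDl.
  move=> /(sol_near_one Phi_1 Phi_2 M0) H.
  near=> eps; have e1 : 0 < eps by near: eps; exact: nbhs_right_gt.
  have [u0 eq1] := u_eq x e1.
  have : 1 - e < u eps x <= 1.
    by apply: (near H eps _ (r x)) => //; rewrite r_ge0 rM.
  by rewrite ltr_norml; lra.
have : phi2 (Num.max 0 (r x * u eps x)) * powR_ratio phi1 s (u eps x) *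
    p1 x `^ s @[eps --> 0^'+]
    --> phi2 (Num.max 0 (r x * 1)) * (left_derive phi1 1)^-1 * p1 x `^ s.
  apply: cvgM; last exact: cvg_cst.
  apply: cvgM.
    by apply: Phi1_cvg => //; apply: cvgM => //; exact: cvg_cst.
  apply/cvgrPdist_lt => e e0.
  have H := powR_ratio_near s0 Phi_1 dphi1 dphi1_gt0 Phi_2 M0 e0.
  near=> eps; have e1 : 0 < eps by near: eps; exact: nbhs_right_gt.
  have [v0 eq1] := u_eq x e1.
  by apply: (near H eps _ (r x)) => //; rewrite r_ge0 rM.
rewrite mulr1 max_r//; apply: cvg_trans; apply: near_eq_cvg; near=> eps.
have e1 : 0 < eps by near: eps; exact: nbhs_right_gt.
have [v0 _] := u_eq x e1.
by rewrite powR_variationE// max_r// mulr_ge0// ltW.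
Unshelve. all: by end_near. Qed.

(** For small eps, monotonicity of phi2 bounds the first factor by phi2 M, and
the second one is within 1 of its limit. *)
Let powR_variation_bound : \forall eps \near 0^'+, forall x, A x ->
  `|G eps x| <= phi2 M * ((left_derive phi1 1)^-1 + 1) * p1 x `^ s.
Proof.
have H1 := sol_near_one Phi_1 Phi_2 M0 ltr01.
have H2 := powR_ratio_near s0 Phi_1 dphi1 dphi1_gt0 Phi_2 M0 ltr01.
near=> eps => x Ax; have e1 : 0 < eps by near: eps; exact: nbhs_right_gt.
have [v0 eq1] := u_eq x e1.
have rxM : 0 <= r x <= M by rewrite r_ge0 rM.
have /andP[_ u1] : 0 < u eps x <= 1 by apply: (near H1 eps _ (r x)).
have K1 : `|(left_derive phi1 1)^-1 - powR_ratio phi1 s (u eps x)| < 1.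
  by apply: (near H2 eps _ (r x)).
have ru0 : 0 <= r x * u eps x by rewrite mulr_ge0// ltW.
rewrite powR_variationE// !normrM [`|p1 x `^ s|]ger0_norm ?powR_ge0//.
rewrite ler_wpM2r ?powR_ge0// ler_pM//.
  rewrite ger0_norm; last exact: Phi1_ge0.
  apply: Phi1_le => //.
  by rewrite (le_trans _ (rM Ax))// ler_piMr.
have D0 : 0 < (left_derive phi1 1)^-1 by rewrite invr_gt0.
by move: K1; rewrite ltr_norml ler_norml; lra.
Unshelve. all: by end_near. Qed.

Let powR_integrable : mu.-integrable A (fun x => (p1 x `^ s)%:E).
Proof.
apply/integrableP; split.
  apply/measurable_EFinP; apply: (measurableT_comp (measurable_powR _)).
  exact: measurable_funTS Fp1.1.
by under eq_integral do rewrite gee0_abs ?lee_fin ?powR_ge0//.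
Qed.

(** The limit of the quotient is written with the inverse of the derivative, so
that a single convergence in the extended reals carries the existence and the
value of the limit. *)
Lemma orlicz_quot_cvg :
  orlicz_quot mu s A phi1 phi2 p1 p2 eps @[eps --> 0^'+] -->
  ((left_derive phi1 1)^-1%:E *
    \int[mu]_(x in A) (phi2 (p2 x / p1 x) * p1 x `^ s)%:E)%E.
Proof.
pose C := phi2 M * ((left_derive phi1 1)^-1 + 1).
have [||||ig iG cG] := @dominated_cvg_at_right _ _ _ mu A mA 0 G
  (fun x => phi2 (r x) * (left_derive phi1 1)^-1 * p1 x `^ s)
  (fun x => C * p1 x `^ s).
- move=> e e0; apply: measurable_funM => //; apply: measurable_funB.
    apply: (measurableT_comp (measurable_powR _)).
    exact: measurable_funTS (measurable_orlicz_add Phi_1.1 Phi_2 e0 Fp1 Fp2).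
  apply: (measurableT_comp (measurable_powR _)).
  exact: measurable_funTS Fp1.1.
- exact: powR_variation_cvg.
- have := integrableZl mA C powR_integrable.
  by apply: eq_integrable => // x _ /=; rewrite EFinM.
- exact: powR_variation_bound.
have ig' : mu.-integrable A (fun x => (phi2 (p2 x / p1 x) * p1 x `^ s)%:E).
  have := integrableZl mA (left_derive phi1 1) ig.
  apply: eq_integrable => // x _ /=; rewrite -EFinM; congr EFin.
  by rewrite /r; field; rewrite !gt_eqF// Fp1.2.
have -> : ((left_derive phi1 1)^-1%:E *
    \int[mu]_(x in A) (phi2 (p2 x / p1 x) * p1 x `^ s)%:E)%E =
  (\int[mu]_(x in A) (phi2 (r x) * (left_derive phi1 1)^-1 * p1 x `^ s)%:E)%E.
  rewrite -integralZl//; apply: eq_integral => x _; rewrite -EFinM.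
  by rewrite mulrCA mulrA.
move: cG; apply: cvg_trans; apply: near_eq_cvg; near=> eps.
have e0 : 0 < eps by near: eps; exact: nbhs_right_gt.
have iGe : mu.-integrable A (EFin \o G eps) by near: eps.
have se0 : s * eps != 0 by rewrite mulf_neq0// gt_eqF.
(* Only now is the s-norm of the Orlicz sum known to be finite, so that the
   difference of the two norms is the integral of the difference. *)
have ilam : mu.-integrable A (EFin \o (fun x => lam eps x `^ s)).
  have := integrableD mA powR_integrable (integrableZl mA (s * eps) iGe).
  apply: eq_integrable => // x _ /=; rewrite -EFinM -EFinD; congr EFin.
  by rewrite /G mulrC divfK// addrC subrK.
rewrite /orlicz_quot /norm_pow -integralB_EFin//.
rewrite inver (negbTE se0) muleC -integralZl//; last exact: integrableB.
by apply: eq_integral => x _; rewrite /G -EFinB -EFinM mulrC.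
Unshelve. all: by end_near. Qed.

End Variation.

(** * Inversion of the argument *)

Section Inversion.
Context {R : realType}.
Implicit Type phi : R -> R.

(** The value 0 at 0 is the limit of phi at infinity when phi is in Psi1. *)
Definition inv_arg phi (t : R) : R := if t == 0 then 0 else phi t^-1.

Lemma inv_argV phi (t : R) : 0 < t -> inv_arg phi t^-1 = phi t.
Proof. by move=> t0; rewrite /inv_arg invr_eq0 gt_eqF// invrK. Qed.

Let near0_inv_arg phi :
  \forall t \near (0 : R)^'+, phi t^-1 = inv_arg phi t.
Proof.
near=> t; have t0 : 0 < t by near: t; exact: nbhs_right_gt.
by rewrite /inv_arg gt_eqF.
Unshelve. all: by end_near. Qed.

Let invr_cvgy : (t : R)^-1 @[t --> 0^'+] --> +oo.
Proof.
apply/(cvgrVy (f := id)); first exact: nbhs_right_gt.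
by apply: cvg_within_filter; exact: cvg_id.
Qed.

Let invr_cvg0 : (t : R)^-1 @[t --> +oo] --> 0^'+.
Proof.
apply: cvg_to_at_right.
  by apply/(gtr0_cvgV0 (f := id)); [exact: nbhs_pinfty_gt|exact: cvg_id].
by near=> t; rewrite invr_gt0; near: t; exact: nbhs_pinfty_gt.
Unshelve. all: by end_near. Qed.

Lemma Phi1_inv_arg phi : Psi1 phi -> Phi1 (inv_arg phi).
Proof.
case=> phi_gt0 cphi phi_lt phi0 phiy.
have inv_in (t : R) : 0 < t -> t^-1 \in `]0, +oo[.
  by rewrite in_itv/= andbT invr_gt0.
split.
- move=> t; rewrite in_itv/= andbT le_eqVlt => /predU1P[<-|t0].
    by rewrite /inv_arg eqxx.
  by rewrite /inv_arg gt_eqF// ltW// phi_gt0// inv_in.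
- apply/continuous_within_itvcyP; split.
    move=> t; rewrite in_itv/= andbT => t0.
    have cV : phi x^-1 @[x --> t] --> phi t^-1.
      have ct : x^-1 @[x --> t] --> t^-1.
        by apply: inv_continuous; rewrite gt_eqF.
      have : {for t^-1, continuous phi}.
        rewrite continuous_open_subspace in cphi; last exact: interval_open.
        by apply: cphi; rewrite inE /= inv_in.
      exact: cvg_comp.
    rewrite /continuous_at {2}/inv_arg gt_eqF//.
    move: cV; apply: cvg_trans; apply: near_eq_cvg; near=> x.
    have x0 : 0 < x by near: x; exact: lt_nbhsr.
    by rewrite /inv_arg gt_eqF.
  rewrite {2}/inv_arg eqxx.
  apply: cvg_trans (near_eq_cvg (near0_inv_arg phi)) _.
  exact: cvg_comp invr_cvgy phiy.
- move=> x y; rewrite !in_itv/= !andbT => x0 y0 xy.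
  have {}y0 : 0 < y by rewrite (le_lt_trans x0).
  move: x0; rewrite le_eqVlt => /predU1P[<-|x0].
    by rewrite /inv_arg eqxx gt_eqF// phi_gt0// inv_in.
  rewrite /inv_arg !gt_eqF//; apply: phi_lt; rewrite ?inv_in//.
  by rewrite ltf_pV2.
- by rewrite /inv_arg eqxx.
- apply: (@cvg_trans _ (phi t^-1 @[t --> +oo])).
    apply: near_eq_cvg; near=> t.
    have t0 : 0 < t by near: t; exact: nbhs_pinfty_gt.
    by rewrite /inv_arg gt_eqF.
  exact: cvg_comp invr_cvg0 phi0.
Unshelve. all: by end_near. Qed.

(** With k = 1 / (1 + h) - 1, which is positive for -1 < h < 0 and tends to 0,
the left quotient at h is the right quotient of phi at k times k / h, and
k / h = - 1 / (1 + h). *)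
Lemma cvg_diff_quot_inv_arg phi : Psi11 phi -> right_derivable phi 1 ->
  diff_quot (inv_arg phi) 1 h @[h --> 0^'-] --> - right_derive phi 1.
Proof.
move=> [Psi phi1] dphi.
have dphiP : diff_quot phi 1 h @[h --> 0^'+] --> right_derive phi 1 := dphi.
have cV1 : (1 + h)^-1 @[h --> (0:R)^'-] --> (1 : R).
  rewrite -[X in _ --> X]invr1; apply: cvgV; first exact: oner_neq0.
  rewrite -[X in _ --> X]addr0; apply: cvgD; first exact: cvg_cst.
  by apply: cvg_within_filter; exact: cvg_id.
have near01 : \forall h \near (0:R)^'-, 0 < 1 + h /\ h < 0.
  near=> h; split; last by near: h; exact: nbhs_left_lt.
  rewrite -ltrBlDl sub0r; near: h.
  by apply: nbhs_left_gt; rewrite oppr_lt0.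
have ck : (1 + h)^-1 - 1 @[h --> (0:R)^'-] --> 0^'+.
  apply: cvg_to_at_right.
    by rewrite -[X in _ --> X](subrr (1:R)); apply: cvgB => //; exact: cvg_cst.
  apply: filterS near01 => h [h0 h1]; rewrite subr_gt0 invf_gt1//; lra.
have : diff_quot phi 1 ((1 + h)^-1 - 1) * - (1 + h)^-1 @[h --> (0:R)^'-]
    --> right_derive phi 1 * - 1.
  by apply: cvgM; [exact: cvg_comp ck dphiP|exact: cvgN].
rewrite mulrN1; apply: cvg_trans; apply: near_eq_cvg.
apply: filterS near01 => h [h0 h1].
have -> : diff_quot (inv_arg phi) 1 h = (phi (1 + h)^-1 - phi 1) / h.
  by rewrite /diff_quot /inv_arg oner_eq0 invr1 gt_eqF.
rewrite /diff_quot (addrC 1 (_ - 1)) subrK.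
have kE : (1 + h)^-1 - 1 = - h * (1 + h)^-1 by field; rewrite gt_eqF.
by rewrite kE; field; rewrite (lt_eqF h1) (gt_eqF h0).
Unshelve. all: by end_near. Qed.

Lemma right_derive_le0 phi : Psi11 phi -> right_derivable phi 1 ->
  right_derive phi 1 <= 0.
Proof.
move=> [[_ _ phi_lt _ _] phi1] dphi.
have dphiP : diff_quot phi 1 h @[h --> 0^'+] --> right_derive phi 1 := dphi.
apply: (cvgr_to_le dphiP); near=> h.
have h0 : 0 < h by near: h; exact: nbhs_right_gt.
rewrite /diff_quot pmulr_lle0 ?invr_gt0// subr_le0 ltW// phi_lt//;
  rewrite ?in_itv/= ?andbT ?ltr01//; lra.
Unshelve. all: by end_near. Qed.

Context {d : measure_display} {T : measurableType d}.

(** The inverses of the solutions for (phi1, phi2, p1, p2) are the solutions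
for the transformed data, where existence and uniqueness are known. *)
Lemma orlicz_add_inv_arg phi1 phi2 eps (p1 p2 : T -> R) x :
  Psi1 phi1 -> Psi1 phi2 -> 0 < eps -> 0 < p1 x -> 0 < p2 x ->
  let q1 x := (p1 x)^-1 in let q2 x := (p2 x)^-1 in
  0 < orlicz_add (inv_arg phi1) (inv_arg phi2) eps q1 q2 x /\
  orlicz_add phi1 phi2 eps p1 p2 x =
  (orlicz_add (inv_arg phi1) (inv_arg phi2) eps q1 q2 x)^-1.
Proof.
move=> /[dup] Psi_1 /Phi1_inv_arg Phi_1 /[dup] Psi_2 /Phi1_inv_arg Phi_2.
move=> e0 a0 b0 q1 q2.
have q10 : 0 < q1 x by rewrite invr_gt0.
have q20 : 0 < q2 x by rewrite invr_gt0.
have [] := orlicz_addP Phi_1 Phi_2 e0 q10 (ltW q20).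
set lam := orlicz_add (inv_arg _) _ _ _ _ _ => lam0 eqlam; split => //.
have invE (phi : R -> R) a l : 0 < a -> 0 < l ->
    inv_arg phi (a^-1 / l) = phi (a / l^-1).
  by move=> ? ?; rewrite -invfM inv_argV ?invrK// mulr_gt0.
rewrite /orlicz_add ltr_wpDr ?(ltW b0)//; apply: xget_unique => /=.
  by rewrite invr_gt0 -!invE.
move=> l [l0 eql]; rewrite -[l]invrK; congr (_^-1).
have l'0 : 0 < l^-1 by rewrite invr_gt0.
apply: (orlicz_eq_unique Phi_1 Phi_2 e0 q10 (ltW q20)) => //.
by rewrite !invE// invrK.
Qed.

Lemma calFposW (p : T -> R) : calFpos p -> calF p.
Proof. by move=> [mp p_gt0]; split => // x; exact: ltW. Qed.

Lemma calFpos_inv (p : T -> R) : calFpos p -> calFpos (fun x => (p x)^-1).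
Proof.
move=> [mp p_gt0]; split; last by move=> x; rewrite invr_gt0.
rewrite (_ : (fun _ => _) = (fun x => p x `^ (- 1))).
  exact: (measurableT_comp (measurable_powR _)).
by apply/funext => x; rewrite powR_inv1// ltW.
Qed.

Lemma powR_inv_opp (a s : R) : 0 < a -> (a^-1) `^ (- s) = a `^ s.
Proof. by move=> a0; rewrite -powR_inv1 ?ltW// -powRrM mulrNN mul1r. Qed.

(** Both norms are unchanged and only the divisor s * eps changes sign. *)
Lemma orlicz_quot_inv_arg (mu : {measure set T -> \bar R}) (s : R) (A : set T)
    phi1 phi2 (p1 p2 : T -> R) eps :
  Psi1 phi1 -> Psi1 phi2 -> 0 < eps -> s != 0 ->
  (forall x, 0 < p1 x) -> (forall x, 0 < p2 x) ->
  orlicz_quot mu s A phi1 phi2 p1 p2 eps =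
  (- orlicz_quot mu (- s) A (inv_arg phi1) (inv_arg phi2)
       (fun x => (p1 x)^-1%R) (fun x => (p2 x)^-1%R) eps)%E.
Proof.
move=> Psi_1 Psi_2 e0 s0 p1_gt0 p2_gt0.
have normE : norm_pow mu (- s) A (fun x => (p1 x)^-1) = norm_pow mu s A p1.
  by apply: eq_integral => x _; rewrite powR_inv_opp.
have addE : norm_pow mu s A (orlicz_add phi1 phi2 eps p1 p2) =
    norm_pow mu (- s) A (orlicz_add (inv_arg phi1) (inv_arg phi2) eps
      (fun x => (p1 x)^-1) (fun x => (p2 x)^-1)).
  apply: eq_integral => x _.
  have [l0 ->] := orlicz_add_inv_arg Psi_1 Psi_2 e0 (p1_gt0 x) (p2_gt0 x).
  by rewrite -powR_inv_opp ?invr_gt0// invrK.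
rewrite /orlicz_quot normE addE !inver !mulf_eq0 oppr_eq0 (negbTE s0) gt_eqF//=.
by rewrite mulNr invrN EFinN muleN oppeK.
Qed.

End Inversion.

Theorem theorem9 (R : realType) (d : measure_display) (T : measurableType d)
    (mu : {measure set T -> \bar R}) (hmu : mu setT <> 0%E)
    (s : R) (hs : s != 0) (A : set T) (mA : measurable A)
    (hA : mu A <> 0%E) :
  (forall phi1 phi2 : R -> R,
     Phi11 phi1 -> Phi11 phi2 ->
     left_derivable phi1 1 -> 0 < left_derive phi1 1 ->
   forall p1 p2 : T -> R,
     (calFpos `&` calL mu s A) p1 -> (calF `&` calL mu s A) p2 ->
   forall a1 : R,
     (ereal_sup [set (p2 x / p1 x)%:E | x in A] < a1%:E)%E ->
   cvg (orlicz_quot mu s A phi1 phi2 p1 p2 eps @[eps --> 0^'+]) /\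
   ((left_derive phi1 1)%:E *
      lim (orlicz_quot mu s A phi1 phi2 p1 p2 eps @[eps --> 0^'+]) =
    \int[mu]_(x in A) (phi2 (p2 x / p1 x) * p1 x `^ s)%:E)%E)
  /\
  (forall phi1 phi2 : R -> R,
     Psi11 phi1 -> Psi11 phi2 ->
     right_derivable phi1 1 -> right_derive phi1 1 != 0 ->
   forall p1 p2 : T -> R,
     (calFpos `&` calL mu s A) p1 -> (calFpos `&` calL mu s A) p2 ->
   forall a2 : R, 0 < a2 ->
     (a2%:E < ereal_inf [set (p2 x / p1 x)%:E | x in A])%E ->
   cvg (orlicz_quot mu s A phi1 phi2 p1 p2 eps @[eps --> 0^'+]) /\
   ((right_derive phi1 1)%:E *
      lim (orlicz_quot mu s A phi1 phi2 p1 p2 eps @[eps --> 0^'+]) =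
    \int[mu]_(x in A) (phi2 (p2 x / p1 x) * p1 x `^ s)%:E)%E).
Proof.
split.
- move=> phi1 phi2 Phi_1 [Phi_2 _] dphi dphi0 p1 p2.
  move=> [Fp1 [_ Lp1]] [Fp2 _] a1 sup_a1.
  have rM x : A x -> p2 x / p1 x <= `|a1|.
    move=> Ax; rewrite (le_trans _ (ler_norm a1))// -lee_fin.
    by apply: le_trans (ltW sup_a1); apply: ereal_sup_ubound; exists x.
  have cq := orlicz_quot_cvg mA hs Phi_1 Phi_2 dphi dphi0 Fp1 Fp2
    (normr_ge0 a1) rM Lp1.
  split; first by apply/cvg_ex; eexists; exact: cq.
  by rewrite (cvg_lim _ cq)// muleA -EFinM divff ?gt_eqF// mul1e.
- move=> phi1 phi2 [Psi_1 phi11] [Psi_2 _] dphi dphi0 p1 p2.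
  move=> [Fp1 [_ Lp1]] [Fp2 _] a2 a20 inf_a2.
  have Phi_1 : Phi11 (inv_arg phi1).
    by split; [exact: Phi1_inv_arg|rewrite -[1 in LHS]invr1 inv_argV].
  have dE := cvg_diff_quot_inv_arg (conj Psi_1 phi11) dphi.
  have ldE : left_derive (inv_arg phi1) 1 = - right_derive phi1 1.
    exact: cvg_lim dE.
  have ld : left_derivable (inv_arg phi1) 1.
    by apply/cvg_ex; eexists; exact: dE.
  have ld0 : 0 < left_derive (inv_arg phi1) 1.
    rewrite ldE oppr_gt0 lt_neqAle dphi0.
    exact: right_derive_le0.
  have rM x : A x -> (p2 x)^-1 / (p1 x)^-1 <= a2^-1.
    move=> Ax; rewrite -invfM lef_pV2 ?posrE ?divr_gt0 ?Fp1.2 ?Fp2.2//.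
    rewrite -lee_fin (le_trans (ltW inf_a2))//.
    by apply: ereal_inf_lbound; exists x.
  have Lq1 : (norm_pow mu (- s) A (fun x => (p1 x)^-1%R) < +oo)%E.
    rewrite (_ : norm_pow _ _ _ _ = norm_pow mu s A p1)//.
    by apply: eq_integral => x _; rewrite powR_inv_opp// Fp1.2.
  have s0N : - s != 0 by rewrite oppr_eq0.
  have a2V : 0 <= a2^-1 by rewrite invr_ge0 ltW.
  have cq := orlicz_quot_cvg mA s0N Phi_1 (Phi1_inv_arg Psi_2) ld ld0
    (calFpos_inv Fp1) (calFposW (calFpos_inv Fp2)) a2V rM Lq1.
  have intE : (\int[mu]_(x in A)
      (inv_arg phi2 ((p2 x)^-1 / (p1 x)^-1) * (p1 x)^-1 `^ (- s))%:E =
      \int[mu]_(x in A) (phi2 (p2 x / p1 x) * p1 x `^ s)%:E)%E.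
    apply: eq_integral => x _; rewrite powR_inv_opp ?Fp1.2//.
    by rewrite -invfM inv_argV// divr_gt0 ?Fp1.2 ?Fp2.2.
  rewrite intE in cq.
  have {}cq : orlicz_quot mu s A phi1 phi2 p1 p2 eps @[eps --> 0^'+] -->
    ((right_derive phi1 1)^-1%:E *
      \int[mu]_(x in A) (phi2 (p2 x / p1 x) * p1 x `^ s)%:E)%E.
    rewrite ldE invrN EFinN mulNe in cq.
    move/cvgeN : cq; rewrite oppeK.
    apply: cvg_trans; apply: near_eq_cvg.
    near=> eps; have e0 : 0 < eps by near: eps; exact: nbhs_right_gt.
    by rewrite (orlicz_quot_inv_arg _ _ Psi_1 Psi_2 e0 hs Fp1.2 Fp2.2).
  split; first by apply/cvg_ex; eexists; exact: cq.
  by rewrite (cvg_lim _ cq)// muleA -EFinM divff// mul1e.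
Unshelve. all: by end_near. Qed.
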